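(* Any circle packing with univalent flowers of the hexagonal triangulation $\mathcal{T}_H$ in the complex plane $\mathbb{C}$ is either a regular hexagonal packing or a Doyle spiral.
   Context: The hexagonal triangulation $\mathcal{T}_H=(H,E_H,F_H)$ of $\mathbb{C}$ has vertex set $H=\{v_{m,n}=m+ne^{\pi i/3}: m,n\in\mathbb{Z}\}$; two vertices $v,w\in H$ are joined by an edge iff $|v-w|=1$ (so the neighbors of $v_{m,n}$ are $v_{m\pm1,n}$, $v_{m,n\pm1}$, $v_{m+1,n-1}$, $v_{m-1,n+1}$); faces are the triples of pairwise adjacent vertices, oriented as in $\mathbb{C}$. A circle packing of $\mathcal{T}_H$ in $\mathbb{C}$ is a family of circles $\{C_v\}_{v\in H}$ in $\mathbb{C}$ (of positive radii) such that (1) $C_v$ and $C_w$ are externally tangent whenever $\{v,w\}\in E_H$; (2) whenever $(v_1,v_2,v_3)$ is a positively oriented face, the triple $(C_{v_1},C_{v_2},C_{v_3})$ is positively oriented (the centers are in counterclockwise order). The flower $\mathcal{F}(v)$ of a vertex $v$ is the set of circles consisting of $C_v$ and the circles $C_w$ for all neighbors $w$ of $v$. The packing is a circle packing with univalent flowers if for each vertex $v$ the circles in $\mathcal{F}(v)$ have mutually disjoint interiors (i.e. the open disks they bound are pairwise disjoint). Circles not contained in a common flower may overlap. Let $r_{m,n}$ denote the radius of the circle at $v_{m,n}$. A regular hexagonal packing is a circle packing of $\mathcal{T}_H$ all of whose radii are equal. A Doyle spiral is a circle packing of $\mathcal{T}_H$ whose radii are $r_{m,n}=r_0x^my^n$ for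 all $m,n\in\mathbb{Z}$, for some constants $r_0,x,y>0$. *)

(* Defs.v *)
From Stdlib Require Import List Reals ZArith Lra Lia Psatz.
From Coquelicot Require Import Coquelicot.
Import ListNotations.
Open Scope R_scope.

(** The pair [(m, n)] stands for the vertex [v_{m,n}]; [hex_point] gives its
    position [m + n e^{pi i/3}] in the plane, from which edges and faces are
    read off. *)
Definition vertex : Set := (Z * Z)%type.

Definition expi (t : R) : C := (cos t, sin t).

Definition hex_point (v : vertex) : C :=
  (RtoC (IZR (fst v)) + RtoC (IZR (snd v)) * expi (PI / 3))%C.

Definition hex_edge (v w : vertex) : Prop :=
  Cmod (hex_point v - hex_point w)%C = 1.

Definition hex_face (v1 v2 v3 : vertex) : Prop :=
  hex_edge v1 v2 /\ hex_edge v2 v3 /\ hex_edge v3 v1.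

(** [Im (conj u * w)] is the cross product of [u] and [w], so this says that
    the (non-collinear) triple [a, b, c] is in counterclockwise order. *)
Definition ccw (a b c : C) : Prop :=
  0 < Im (Cconj (b - a) * (c - a))%C.

Definition hex_positive_face (v1 v2 v3 : vertex) : Prop :=
  hex_face v1 v2 v3 /\ ccw (hex_point v1) (hex_point v2) (hex_point v3).

Record circle : Set := Circle { center : C; radius : R }.

Definition open_disk (K : circle) (z : C) : Prop :=
  Cmod (z - center K)%C < radius K.

Definition disjoint_interiors (K L : circle) : Prop :=
  forall z : C, ~ (open_disk K z /\ open_disk L z).

Definition externally_tangent (K L : circle) : Prop :=
  Cmod (center K - center L)%C = radius K + radius L.

Definition circle_packing (P : vertex -> circle) : Prop :=
  (forall v, 0 < radius (P v)) /\
  (forall v w, hex_edge v w -> externally_tangent (P v) (P w)) /\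
  (forall v1 v2 v3, hex_positive_face v1 v2 v3 ->
     ccw (center (P v1)) (center (P v2)) (center (P v3))).

(** The vertices indexing the circles of the flower of [v]. *)
Definition in_flower (v w : vertex) : Prop := w = v \/ hex_edge v w.

(** Disjointness is required for distinct indices, so that two petals of a
    flower may not be the same circle. *)
Definition univalent_flowers (P : vertex -> circle) : Prop :=
  forall v w1 w2, in_flower v w1 -> in_flower v w2 -> w1 <> w2 ->
    disjoint_interiors (P w1) (P w2).

Definition regular_hexagonal_packing (P : vertex -> circle) : Prop :=
  circle_packing P /\ forall v w, radius (P v) = radius (P w).

Definition doyle_spiral (P : vertex -> circle) : Prop :=
  circle_packing P /\
  exists r0 x y : R, 0 < r0 /\ 0 < x /\ 0 < y /\
    forall m n : Z, radius (P (m, n)) = r0 * powerRZ x m * powerRZ y n.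

Lemma hex_edgeE (m n m' n' : Z) :
  hex_edge (m, n) (m', n') <->
  In (m', n')
    [(m + 1, n); (m - 1, n); (m, n + 1); (m, n - 1);
     (m + 1, n - 1); (m - 1, n + 1)]%Z.
Proof.
set (a := (m' - m)%Z); set (b := (n' - n)%Z).
assert (E : hex_edge (m, n) (m', n') <-> (a * a + a * b + b * b = 1)%Z).
{ unfold hex_edge, hex_point, expi, Cmod; simpl.
  rewrite cos_PI3, sin_PI3.
  assert (S : sqrt 3 * sqrt 3 = 3) by (apply sqrt_sqrt; lra).
  match goal with |- sqrt ?x = 1 <-> _ =>
    assert (X : x = IZR (a * a + a * b + b * b)) end.
  { unfold a, b; rewrite !plus_IZR, !mult_IZR, !minus_IZR.
    set (s := sqrt 3) in *.
    match goal with |- ?l = ?r =>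
      assert (l - r = (s * s - 3) * (IZR n - IZR n') ^ 2 / 4) by field end.
    rewrite S in H; lra. }
  rewrite X; split; intro H.
  - apply eq_IZR.
    rewrite <- (sqrt_sqrt (IZR _)); [rewrite H; lra | apply IZR_le; nia].
  - rewrite H; apply sqrt_1. }
rewrite E; simpl; rewrite !pair_equal_spec; split; intro H.
- assert (-1 <= a <= 1)%Z by nia.
  assert (-1 <= b <= 1)%Z by nia.
  assert (Ha : (a = -1 \/ a = 0 \/ a = 1)%Z) by lia.
  assert (Hb : (b = -1 \/ b = 0 \/ b = 1)%Z) by lia.
  destruct Ha as [A | [A | A]]; destruct Hb as [B | [B | B]];
    rewrite A, B in H; try discriminate H; unfold a, b in *; lia.
- assert (Hab : ((a = 1 /\ b = 0) \/ (a = -1 /\ b = 0) \/ (a = 0 /\ b = 1) \/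
     (a = 0 /\ b = -1) \/ (a = 1 /\ b = -1) \/ (a = -1 /\ b = 1))%Z)
    by (unfold a, b; lia).
  destruct Hab as [[A B]|[[A B]|[[A B]|[[A B]|[[A B]|[A B]]]]]];
    rewrite A, B; reflexivity.
Qed.

(* Main.v *)
(** Let [u] be the logarithm of the radius. Univalence forces the six angles
    around each circle to sum to [2 PI] (and not [4 PI]), and the Ring Lemma
    bounds the differences of [u] along edges. Translating the packing by a
    lattice vector gives a second solution [u + w] of the angle equations with
    [w] bounded. In a triangle of tangent circles with incircle radius [rho], the
    derivative of the angle at [r_i] with respect to [ln r_j] is
    [rho / (r_i + r_j)], which is symmetric, positive and at most [1]; averaging
    it over the segment from [u] to [u + w] makes [w] a harmonic function for
    bounded conductances on the triangular lattice. This network is recurrent, so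
    [w] is constant. Hence [u] is affine, which is a Doyle spiral (a regular
    hexagonal packing being the case [x = y = 1]). *)

From Stdlib Require Import Reals ZArith Psatz Classical.
From Coquelicot Require Import Coquelicot.
Require Import Defs.
Open Scope R_scope.

(** * Angles in triangles of tangent circles *)

(** Angle at the centre of radius [r] in the triangle of centres of tangent circles of radii [r],
    [a], [b]: the tangent of its half is the inradius divided by [r]. *)
Definition corner_angle (r a b : R) : R :=
  2 * atan (sqrt (a * b / (r * (r + a + b)))).

Lemma corner_angle_bounds r a b :
  0 < r -> 0 < a -> 0 < b -> 0 < corner_angle r a b < PI.
Proof.
intros Hr Ha Hb; unfold corner_angle.
assert (0 < sqrt (a * b / (r * (r + a + b)))).
{ apply sqrt_lt_R0, Rdiv_lt_0_compat; repeat apply Rmult_lt_0_compat; lra. }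
assert (H0 := atan_increasing _ _ H); rewrite atan_0 in H0.
assert (H1 := atan_bound (sqrt (a * b / (r * (r + a + b))))); lra.
Qed.

(** The law of cosines, in a form that separates [a] from [b]. *)
Lemma cos_corner_angle r a b :
  0 < r -> 0 < a -> 0 < b ->
  cos (corner_angle r a b) = 1 - 2 * (a / (r + a)) * (b / (r + b)).
Proof.
intros Hr Ha Hb; unfold corner_angle.
set (q := a * b / (r * (r + a + b))).
assert (Hq : 0 < q).
{ apply Rdiv_lt_0_compat; repeat apply Rmult_lt_0_compat; lra. }
rewrite cos_2a_cos, cos_atan.
assert (S : 1 + (sqrt q)² = 1 + q) by (rewrite Rsqr_sqrt; lra).
rewrite S.
assert (E : 1 / sqrt (1 + q) * (1 / sqrt (1 + q)) = 1 / (1 + q)).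
{ replace (1 / sqrt (1 + q) * (1 / sqrt (1 + q)))
    with (1 / (sqrt (1 + q) * sqrt (1 + q))).
  - rewrite sqrt_sqrt; lra.
  - field; apply Rgt_not_eq, sqrt_lt_R0; lra. }
rewrite Rmult_assoc, E; unfold q; field.
repeat split; try lra; nra.
Qed.

(** The square is the sine of half the angle under which the petal is seen; the sine of half a
    corner angle is then a product of two sizes. *)
Definition petal_size (r a : R) : R := sqrt (a / (r + a)).

Lemma petal_size_sqr r a :
  0 < r -> 0 < a -> petal_size r a * petal_size r a = a / (r + a).
Proof.
intros Hr Ha; apply sqrt_sqrt, Rlt_le, Rdiv_lt_0_compat; lra.
Qed.

Lemma petal_size_bounds r a :
  0 < r -> 0 < a -> 0 < petal_size r a <= 1.
Proof.
intros Hr Ha; split.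
- apply sqrt_lt_R0, Rdiv_lt_0_compat; lra.
- rewrite <- sqrt_1; apply sqrt_le_1_alt.
  apply Rmult_le_reg_r with (r + a); [lra|].
  unfold Rdiv; rewrite Rmult_assoc, Rinv_l; lra.
Qed.

Lemma cos_corner_angle_size r a b :
  0 < r -> 0 < a -> 0 < b ->
  cos (corner_angle r a b) = 1 - 2 * (petal_size r a * petal_size r b)².
Proof.
intros Hr Ha Hb; rewrite cos_corner_angle by assumption.
rewrite <- (petal_size_sqr r a), <- (petal_size_sqr r b) by assumption.
unfold Rsqr; ring.
Qed.

Lemma sin_half_corner_angle r a b :
  0 < r -> 0 < a -> 0 < b ->
  sin (corner_angle r a b / 2) = petal_size r a * petal_size r b.
Proof.
intros Hr Ha Hb.
destruct (corner_angle_bounds r a b Hr Ha Hb).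
destruct (petal_size_bounds r a Hr Ha), (petal_size_bounds r b Hr Hb).
apply Rsqr_inj.
- apply sin_ge_0; lra.
- nra.
- assert (C := cos_corner_angle_size r a b Hr Ha Hb).
  replace (corner_angle r a b) with (2 * (corner_angle r a b / 2)) in C by lra.
  rewrite cos_2a_sin in C; unfold Rsqr in *; lra.
Qed.

Lemma cos_corner_angle_le r a a' b :
  0 < r -> 0 < a <= a' -> 0 < b ->
  cos (corner_angle r a' b) <= cos (corner_angle r a b).
Proof.
intros Hr Ha Hb; rewrite !cos_corner_angle by lra.
assert (0 < b / (r + b)) by (apply Rdiv_lt_0_compat; lra).
assert (a / (r + a) <= a' / (r + a')).
{ assert (a' / (r + a') - a / (r + a) = r * (a' - a) / ((r + a) * (r + a')))
    by (field; lra).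
  assert (0 <= r * (a' - a) / ((r + a) * (r + a')))
    by (apply Rdiv_le_0_compat; nra).
  lra. }
nra.
Qed.

Lemma corner_angle_sym r a b : corner_angle r a b = corner_angle r b a.
Proof.
unfold corner_angle; rewrite (Rmult_comm b a).
now replace (r + b + a) with (r + a + b) by ring.
Qed.

(** * Flowers and their angle sum *)

(** The angle swept from petal [k] to petal [n + k], not reduced modulo [2 * PI], so that winding
    twice differs from winding once. *)
Fixpoint turning (r : R) (a : nat -> R) (k n : nat) : R :=
  match n with
  | O => 0
  | S n => turning r a k n + corner_angle r (a (n + k)%nat) (a (S (n + k)))
  end.

Lemma turning_ext r a a' k n :
  (forall i, a i = a' i) -> turning r a k n = turning r a' k n.
Proof. intros E; induction n as [|n IH]; simpl; [easy|]; now rewrite IH, !E. Qed.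

(** The petals of a flower around a circle of radius [r], seen from its centre:
    by the law of cosines, [flower_disjoint] says that the distance between the
    centres of distinct petals is at least the sum of their radii. *)
Record flower (r : R) (a : nat -> R) : Prop := {
  flower_centre : 0 < r;
  flower_petal : forall k, 0 < a k;
  flower_period : forall k, a (6 + k)%nat = a k;
  flower_closed : forall k,
    cos (turning r a k 6) = 1 /\ sin (turning r a k 6) = 0;
  flower_disjoint : forall k n, (0 < n < 6)%nat ->
    cos (turning r a k n) <= cos (corner_angle r (a k) (a (n + k)%nat)) }.

Lemma flower_shift r a j : flower r a -> flower r (fun k => a (k + j)%nat).
Proof.
assert (T : forall k n, turning r (fun k => a (k + j)%nat) k n
                        = turning r a (k + j) n).
{ intros k n; induction n as [|n IH]; simpl; [easy|].
  rewrite IH; do 3 f_equal; lia. }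
intros [H1 H2 H3 H4 H5]; split; try easy.
- intros k; exact (H3 (k + j)%nat).
- intros k; rewrite T; apply H4.
- intros k n Hn; rewrite T, <- Nat.add_assoc; now apply H5.
Qed.

Lemma periodic_max (a : nat -> R) :
  (forall k, a (6 + k)%nat = a k) -> exists m, forall k, a k <= a m.
Proof.
intros H.
assert (F : forall n, exists m, forall k, (k <= n)%nat -> a k <= a m).
{ induction n as [|n [m Hm]].
  - exists O; intros k Hk; replace k with O by lia; lra.
  - destruct (Rle_dec (a (S n)) (a m)) as [L|L].
    + exists m; intros k Hk; destruct (Nat.eq_dec k (S n)) as [->|]; [easy|].
      apply Hm; lia.
    + exists (S n); intros k Hk; destruct (Nat.eq_dec k (S n)) as [->|]; [lra|].
      assert (a k <= a m) by (apply Hm; lia); lra. }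
destruct (F 5%nat) as [m Hm]; exists m.
induction k as [k IH] using lt_wf_ind.
destruct (le_lt_dec k 5) as [L|L]; [now apply Hm|].
replace k with (6 + (k - 6))%nat by lia; rewrite H; apply IH; lia.
Qed.

Lemma turning_period r a k :
  (forall k, a (6 + k)%nat = a k) -> turning r a k 6 = turning r a 0 6.
Proof.
intros H; induction k as [|k IH]; [easy|]; rewrite <- IH; simpl.
replace (S (S (S (S (S (S (S k))))))) with (6 + S k)%nat by lia.
rewrite H, <- (H k); simpl; repeat rewrite (Nat.add_succ_r _ k); simpl.
assert (E := H k); simpl in E.
ring_simplify; rewrite E; ring.
Qed.

Lemma cos_le_inv x y : 0 <= x <= PI -> 0 <= y <= PI -> cos x <= cos y -> y <= x.
Proof. intros Hx Hy H; apply cos_decr_0; lra. Qed.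

Lemma flower_corner_bounds r a k :
  flower r a -> 0 < corner_angle r (a k) (a (S k)) < PI.
Proof.
intros F; apply corner_angle_bounds; apply F.
Qed.

(* Seen from the centre, the largest petal would lie in the sector spanned by
   two consecutive other petals; but being larger than both it makes with each
   of them at least the angle of that sector. *)
Lemma no_double_turn r a :
  flower r a -> (forall k, a k <= a O) -> turning r a 0 6 <> 4 * PI.
Proof.
intros F Hmax H4.
(* The direction of petal 0 splits the sector of petals [k] and [S k] into [A] and [B]; each would
   be at least the whole sector. *)
assert (Hsum : forall A B k, 0 < A -> 0 <= B ->
  A + B = corner_angle r (a k) (a (S k)) ->
  cos A <= cos (corner_angle r (a O) (a k)) ->
  cos B <= cos (corner_angle r (a O) (a (S k))) -> False).
{ intros A B k HA HB HAB CA CB.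
  destruct (flower_corner_bounds r a k F).
  assert (cos (corner_angle r (a O) (a k)) <= cos (corner_angle r (a k) (a (S k)))).
  { rewrite (corner_angle_sym r (a k)).
    apply cos_corner_angle_le; try apply F; split; [apply F|apply Hmax]. }
  assert (cos (corner_angle r (a O) (a (S k)))
          <= cos (corner_angle r (a k) (a (S k)))).
  { apply cos_corner_angle_le; try apply F; split; [apply F|apply Hmax]. }
  assert (corner_angle r (a k) (a (S k)) <= A) by (apply cos_le_inv; lra).
  assert (corner_angle r (a k) (a (S k)) <= B) by (apply cos_le_inv; lra).
  lra. }
assert (D : forall n, (0 < n < 6)%nat ->
  cos (turning r a 0 n) <= cos (corner_angle r (a O) (a n))).
{ intros n Hn; assert (E := flower_disjoint r a F 0 n Hn).
  now rewrite Nat.add_0_r in E. }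
assert (P : forall x, cos (2 * PI - x) = cos x).
{ intros x; replace (2 * PI - x) with (- x + 2 * PI) by ring.
  rewrite cos_plus, cos_2PI, sin_2PI, cos_neg; ring. }
assert (B := fun k => flower_corner_bounds r a k F).
assert (B0 := B 0%nat); assert (B1 := B 1%nat); assert (B2 := B 2%nat).
assert (B3 := B 3%nat); assert (B4 := B 4%nat); assert (B5 := B 5%nat).
assert (D2 := D 2%nat ltac:(lia)); assert (D3 := D 3%nat ltac:(lia)).
assert (D4 := D 4%nat ltac:(lia)).
simpl in *.
set (t2 := 0 + corner_angle r (a 0%nat) (a 1%nat)
           + corner_angle r (a 1%nat) (a 2%nat)) in *.
set (t3 := t2 + corner_angle r (a 2%nat) (a 3%nat)) in *.
set (t4 := t3 + corner_angle r (a 3%nat) (a 4%nat)) in *.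
assert (Q : forall x, cos (x - 2 * PI) = cos x).
{ intros x; rewrite <- (P x), <- cos_neg; f_equal; ring. }
(* All corners are below [PI], so [t2 < 2 * PI < t4]: after one full turn petal 0 is met between
   petals 2 and 3 or between petals 3 and 4. *)
destruct (Rle_dec (2 * PI) t3) as [L|L].
- apply (Hsum (2 * PI - t2) (t3 - 2 * PI) 2%nat); rewrite ?P, ?Q; trivial;
    unfold t3, t2 in *; lra.
- apply (Hsum (2 * PI - t3) (t4 - 2 * PI) 3%nat); rewrite ?P, ?Q; trivial;
    unfold t4, t3, t2 in *; lra.
Qed.

(** Closing up makes the sum a multiple of [2 * PI] strictly between 0 and [6 * PI]; shifting the
    indices to start at a largest petal excludes [4 * PI]. *)
Lemma flower_turning r a k : flower r a -> turning r a k 6 = 2 * PI.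
Proof.
intros F; rewrite turning_period by apply F.
destruct (periodic_max a) as [m Hm]; [apply F|].
assert (F' := flower_shift r a m F).
assert (N := no_double_turn r _ F' ltac:(intros i; apply Hm)).
rewrite <- (turning_period r a m) by apply F.
assert (E : turning r (fun k => a (k + m)%nat) 0 6 = turning r a m 6) by reflexivity.
rewrite E in N.
destruct (flower_closed r a F m) as [C S].
assert (B := fun k => flower_corner_bounds r a k F).
assert (R : 0 < turning r a m 6 < 6 * PI).
{ assert (B0 := B m); assert (B1 := B (1 + m)%nat); assert (B2 := B (2 + m)%nat).
  assert (B3 := B (3 + m)%nat); assert (B4 := B (4 + m)%nat).
  assert (B5 := B (5 + m)%nat); simpl in *; lra. }
destruct (sin_eq_0_0 _ S) as [z Hz]; rewrite Hz in *.
assert (HPI := PI_RGT_0).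
assert (Z1 : (0 < z)%Z) by (apply lt_IZR; nra).
assert (Z2 : (z < 6)%Z) by (apply lt_IZR; nra).
assert (C2 : cos (1 * PI) = -1) by (rewrite Rmult_1_l; apply cos_PI).
assert (C3 : cos (3 * PI) = -1).
{ replace (3 * PI) with (PI + 2 * 1 * PI) by ring.
  replace 1 with (INR 1) at 1 by reflexivity; rewrite cos_period; apply cos_PI. }
assert (C5 : cos (5 * PI) = -1).
{ replace (5 * PI) with (PI + 2 * 2 * PI) by ring.
  replace 2 with (INR 2) at 2 by reflexivity; rewrite cos_period; apply cos_PI. }
assert (Hc : (z = 1 \/ z = 2 \/ z = 3 \/ z = 4 \/ z = 5)%Z) by lia.
destruct Hc as [Z|[Z|[Z|[Z|Z]]]]; subst z; lra.
Qed.

(** * The Ring Lemma *)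

(** One of six angles with sum [2 * PI] is at least [PI / 3]; the sine of its half, at least
    [1 / 2], is a product of two sizes that are at most 1. *)
Lemma large_petals r a :
  flower r a -> exists i, (i < 6)%nat /\
    1 / 2 <= petal_size r (a i) /\ 1 / 2 <= petal_size r (a (S i)).
Proof.
intros F.
assert (E : exists i, (i < 6)%nat /\ PI / 3 <= corner_angle r (a i) (a (S i))).
{ apply NNPP; intros N.
  assert (B : forall i, (i < 6)%nat -> corner_angle r (a i) (a (S i)) < PI / 3).
  { intros i Hi; apply Rnot_le_lt; intros L; apply N; now exists i. }
  assert (T := flower_turning r a 0 F); simpl in T.
  assert (B0 := B 0%nat ltac:(lia)); assert (B1 := B 1%nat ltac:(lia)).
  assert (B2 := B 2%nat ltac:(lia)); assert (B3 := B 3%nat ltac:(lia)).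
  assert (B4 := B 4%nat ltac:(lia)); assert (B5 := B 5%nat ltac:(lia)).
  lra. }
destruct E as [i [Hi E]]; exists i; split; [easy|].
destruct (flower_corner_bounds r a i F) as [Bl Bu].
assert (Hr := flower_centre r a F); assert (Ha := flower_petal r a F).
destruct (petal_size_bounds r (a i) Hr (Ha i)).
destruct (petal_size_bounds r (a (S i)) Hr (Ha (S i))).
assert (1 / 2 <= petal_size r (a i) * petal_size r (a (S i))).
{ rewrite <- sin_half_corner_angle, <- sin_PI6 by easy.
  apply sin_incr_1; lra. }
split; nra.
Qed.

Fixpoint psum (f : nat -> R) (n : nat) : R :=
  match n with O => 0 | S n => psum f n + f (S n) end.

(* |sin (T / 2)| is half the distance between the unit vectors enclosing the
   angle T, so this is the triangle inequality along a chain of petals. *)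
Lemma sin_half_turning_le r a k n :
  flower r a ->
  Rabs (sin (turning r a k (S n) / 2))
    <= petal_size r (a k) * petal_size r (a (S k))
       + psum (fun i => petal_size r (a (i + k)%nat)) n.
Proof.
intros F.
assert (Hr := flower_centre r a F); assert (Ha := flower_petal r a F).
assert (B := fun i => petal_size_bounds r (a i) Hr (Ha i)).
induction n as [|n IH].
- simpl; rewrite Rplus_0_l, sin_half_corner_angle by easy.
  assert (B0 := B k); assert (B1 := B (S k)).
  rewrite Rabs_pos_eq; nra.
- change (turning r a k (S (S n))) with
    (turning r a k (S n) + corner_angle r (a (S n + k)%nat) (a (S (S n + k)))).
  change (psum (fun i => petal_size r (a (i + k)%nat)) (S n)) with
    (psum (fun i => petal_size r (a (i + k)%nat)) n + petal_size r (a (S n + k)%nat)).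
  set (t := turning r a k (S n)) in *.
  set (u := corner_angle _ _ _).
  replace ((t + u) / 2) with (t / 2 + u / 2) by field.
  assert (U : sin (u / 2) = petal_size r (a (S n + k)%nat)
                          * petal_size r (a (S (S n + k)))).
  { apply sin_half_corner_angle; easy. }
  assert (B0 := B (S n + k)%nat); assert (B1 := B (S (S n + k))).
  rewrite sin_plus, U.
  eapply Rle_trans; [apply Rabs_triang|].
  rewrite !Rabs_mult, (Rabs_pos_eq (petal_size _ _)),
    (Rabs_pos_eq (petal_size _ _)) by lra.
  assert (C1 : Rabs (cos (u / 2)) <= 1) by (apply Rabs_le; apply COS_bound).
  assert (C2 : Rabs (cos (t / 2)) <= 1) by (apply Rabs_le; apply COS_bound).
  assert (P1 := Rabs_pos (cos (t / 2))); assert (P2 := Rabs_pos (sin (t / 2))).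
  set (x := petal_size r (a (S n + k)%nat)) in *.
  set (y := petal_size r (a (S (S n + k)))) in *.
  assert (x * y <= x) by nra.
  assert (Rabs (cos (t / 2)) * (x * y) <= x) by nra.
  assert (Rabs (sin (t / 2)) * Rabs (cos (u / 2)) <= Rabs (sin (t / 2))) by nra.
  lra.
Qed.

(** Disjoint petals are seen at least as far apart as tangent petals of the same radii. *)
Lemma sin_half_turning_ge r a k n :
  flower r a -> (0 < n < 6)%nat ->
  petal_size r (a k) * petal_size r (a (n + k)%nat)
    <= Rabs (sin (turning r a k n / 2)).
Proof.
intros F Hn.
assert (Hr := flower_centre r a F); assert (Ha := flower_petal r a F).
assert (D := flower_disjoint r a F k n Hn).
rewrite cos_corner_angle_size in D by easy.
replace (turning r a k n) with (2 * (turning r a k n / 2)) in D by field.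
rewrite cos_2a_sin in D.
destruct (petal_size_bounds r (a k) Hr (Ha k)).
destruct (petal_size_bounds r (a (n + k)%nat) Hr (Ha _)).
rewrite <- (Rabs_pos_eq (petal_size _ _ * _)) by nra.
apply Rsqr_le_abs_0; unfold Rsqr in *; lra.
Qed.

(** If the next petal were tiny, the following ones, squeezed towards petal [k] and disjoint from
    it, would be tiny in turn, against [large_petals]. *)
Lemma petal_size_succ r a k c :
  flower r a -> 0 < c -> c <= petal_size r (a k) ->
  1 / (2 * (1 + 1 / c) ^ 5) <= petal_size r (a (S k)).
Proof.
intros F Hc Hk.
assert (Hr := flower_centre r a F); assert (Ha := flower_petal r a F).
assert (B := fun i => petal_size_bounds r (a i) Hr (Ha i)).
set (f := fun i => petal_size r (a (i + k)%nat)).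
assert (D1 : 0 < 1 / c) by (apply Rdiv_lt_0_compat; lra).
(* The half-turning sine is bounded below by disjointness from petal [k] and above by the chain of
   petals. *)
assert (step : forall n, (n < 5)%nat -> c * f (S n) <= f 1%nat + psum f n).
{ intros n Hn.
  assert (L := sin_half_turning_le r a k n F).
  assert (G := sin_half_turning_ge r a k (S n) F ltac:(lia)).
  assert (B0 := B k); assert (B1 := B (S k)); assert (B2 := B (S n + k)%nat).
  fold f in L; change (petal_size r (a (S n + k)%nat)) with (f (S n)) in *.
  change (petal_size r (a (S k))) with (f 1%nat) in *.
  assert (petal_size r (a k) * f 1%nat <= f 1%nat) by nra.
  assert (c * f (S n) <= petal_size r (a k) * f (S n)) by nra.
  lra. }
(* Discrete Gronwall: the partial sums grow at most geometrically. *)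
assert (V : forall n, (n <= 5)%nat -> f 1%nat + psum f n <= f 1%nat * (1 + 1 / c) ^ n).
{ induction n as [|n IH]; intros Hn; [simpl; lra|].
  specialize (IH ltac:(lia)); specialize (step n ltac:(lia)); simpl.
  assert (f (S n) <= (1 / c) * (f 1%nat + psum f n)).
  { apply Rmult_le_reg_l with c; [lra|].
    replace (c * (1 / c * (f 1%nat + psum f n))) with (f 1%nat + psum f n)
      by (field; lra); lra. }
  assert (0 < f (S n)) by apply B.
  nra. }
assert (Fp : forall n, 0 < f n) by (intros n; apply B).
assert (Sp : forall n, 0 <= psum f n).
{ induction n; simpl; [lra|]; specialize (Fp (S n)); lra. }
assert (U : forall n, (n < 5)%nat -> f (S n) <= f 1%nat * (1 + 1 / c) ^ 5).
{ intros n Hn; specialize (V (S n) ltac:(lia)); cbn [psum] in V.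
  assert (f (S n) <= f 1%nat * (1 + 1 / c) ^ (S n)).
  { assert (P := Sp n); assert (P1 := Fp 1%nat); lra. }
  eapply Rle_trans; [eassumption|].
  apply Rmult_le_compat_l; [apply Rlt_le, Fp|].
  apply Rle_pow; [lra|lia]. }
(* Two adjacent petals among [k], ..., [k + 6] are large, so one of them is among [k + 1], ...,
   [k + 5]. *)
destruct (large_petals r _ (flower_shift r a k F)) as [i [Hi [H1 H2]]].
assert (E : 1 / 2 <= f 1%nat * (1 + 1 / c) ^ 5).
{ destruct i as [|i].
  - eapply Rle_trans; [exact H2|]; apply (U O); lia.
  - eapply Rle_trans; [exact H1|]; apply (U i); lia. }
assert (P5 : 0 < (1 + 1 / c) ^ 5) by (apply pow_lt; lra).
change (petal_size r (a (S k))) with (f 1%nat).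
set (d := (1 + 1 / c) ^ 5) in *.
apply Rmult_le_reg_r with d; [easy|].
now replace (1 / (2 * d) * d) with (1 / 2) by (field; lra).
Qed.

(** Starting from a large petal, [petal_size_succ] carries a lower bound around the flower, with
    constants independent of the flower. *)
Lemma ring_lemma :
  exists M, 0 < M /\ forall r a k, flower r a -> r <= M * a k.
Proof.
assert (G : forall n, exists c, 0 < c /\ forall r a k, flower r a ->
  1 / 2 <= petal_size r (a k) -> forall i, (i <= n)%nat ->
  c <= petal_size r (a (i + k)%nat)).
{ induction n as [|n [c [Hc IH]]].
  - exists (1 / 2); split; [lra|]; intros r a k _ H i Hi.
    now replace i with O by lia.
  - assert (0 < 1 / c) by (apply Rdiv_lt_0_compat; lra).
    exists (Rmin c (1 / (2 * (1 + 1 / c) ^ 5))); split.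
    + apply Rmin_pos; [easy|]; apply Rdiv_lt_0_compat; [lra|].
      apply Rmult_lt_0_compat; [lra|]; apply pow_lt; lra.
    + intros r a k F L i Hi.
      destruct (Nat.eq_dec i (S n)) as [->|].
      * eapply Rle_trans; [apply Rmin_r|]; simpl.
        apply petal_size_succ; try easy; now apply IH.
      * eapply Rle_trans; [apply Rmin_l|]; apply IH; trivial; lia. }
(* From an index [i < 6], each index [6 + k] with [k < 6] is at most 11 steps away. *)
destruct (G 11%nat) as [c [Hc H]]; exists (/ (c * c)); split.
{ apply Rinv_0_lt_compat; nra. }
assert (K : forall r a k, flower r a -> (k < 6)%nat -> c <= petal_size r (a k)).
{ intros r a k F Hk; destruct (large_petals r a F) as [i [Hi [L _]]].
  rewrite <- (flower_period r a F).
  replace (6 + k)%nat with ((6 + k - i) + i)%nat by lia; apply H; trivial; lia. }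
assert (K' : forall r a k, flower r a -> c <= petal_size r (a k)).
{ intros r a k F; induction k as [k IH] using lt_wf_ind.
  destruct (le_lt_dec 6 k) as [L|L]; [|now apply K].
  replace k with (6 + (k - 6))%nat by lia; rewrite (flower_period r a F).
  apply IH; lia. }
intros r a k F; specialize (K' r a k F).
assert (Hr := flower_centre r a F); assert (Ha := flower_petal r a F k).
assert (E := petal_size_sqr r (a k) Hr Ha).
assert (Q : c * c <= a k / (r + a k)) by (rewrite <- E; nra).
apply Rmult_le_reg_l with (c * c); [nra|].
rewrite <- Rmult_assoc, Rinv_r by nra.
assert (c * c * (r + a k) <= a k).
{ replace (a k) with (a k / (r + a k) * (r + a k)) at 2 by (field; lra).
  apply Rmult_le_compat_r; lra. }
nra.
Qed.

(** * Variation of the corner angles *)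

(** The derivative of [corner_angle r a b] with respect to [ln a]; the square
    root is the radius of the incircle of the triangle of centres. *)
Definition edge_weight (r a b : R) : R :=
  sqrt (r * a * b / (r + a + b)) / (r + a).

Lemma edge_weight_sym r a b : edge_weight r a b = edge_weight a r b.
Proof.
unfold edge_weight; rewrite (Rmult_comm a r).
replace (a + r + b) with (r + a + b) by ring; now rewrite (Rplus_comm a r).
Qed.

Lemma edge_weight_bounds r a b :
  0 < r -> 0 < a -> 0 < b -> 0 < edge_weight r a b <= 1.
Proof.
intros Hr Ha Hb; unfold edge_weight; split.
- apply Rdiv_lt_0_compat; [|lra].
  apply sqrt_lt_R0, Rdiv_lt_0_compat; [|lra]; repeat apply Rmult_lt_0_compat; lra.
- apply Rmult_le_reg_r with (r + a); [lra|].
  unfold Rdiv; rewrite Rmult_assoc, Rinv_l, Rmult_1_r, Rmult_1_l by lra.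
  rewrite <- (sqrt_pow2 (r + a)) at 2 by lra; apply sqrt_le_1_alt.
  apply Rmult_le_reg_r with (r + a + b); [lra|].
  rewrite Rmult_assoc, Rinv_l, Rmult_1_r by lra.
  assert (0 <= r * a * b) by (apply Rlt_le; repeat apply Rmult_lt_0_compat; lra).
  assert (r * a * b <= (r + a) ^ 2 * b) by (apply Rmult_le_compat_r; nra).
  assert (0 <= (r + a) ^ 3) by (apply pow_le; lra).
  lra.
Qed.

(** Scaling all radii preserves the angle, so only the differences [w1 - w0] and [w2 - w0] enter. *)
Lemma is_derive_corner_angle (u0 u1 u2 w0 w1 w2 t : R) :
  is_derive (fun t => corner_angle (exp (u0 + t * w0)) (exp (u1 + t * w1))
                        (exp (u2 + t * w2))) t
    ((w1 - w0) * edge_weight (exp (u0 + t * w0)) (exp (u1 + t * w1))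
                   (exp (u2 + t * w2)) +
     (w2 - w0) * edge_weight (exp (u0 + t * w0)) (exp (u2 + t * w2))
                   (exp (u1 + t * w1))).
Proof.
unfold corner_angle, edge_weight.
assert (H0 := exp_pos (u0 + t * w0)); assert (H1 := exp_pos (u1 + t * w1)).
assert (H2 := exp_pos (u2 + t * w2)).
assert (Q : 0 < exp (u1 + t * w1) * exp (u2 + t * w2) /
   (exp (u0 + t * w0) * (exp (u0 + t * w0) + exp (u1 + t * w1) + exp (u2 + t * w2)))).
{ apply Rdiv_lt_0_compat; repeat apply Rmult_lt_0_compat; lra. }
auto_derive.
- repeat split; trivial.
  apply Rgt_not_eq; repeat apply Rmult_lt_0_compat; lra.
- set (r := exp (u0 + t * w0)) in *; set (a := exp (u1 + t * w1)) in *.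
  set (b := exp (u2 + t * w2)) in *.
  set (q := a * b / (r * (r + a + b))) in *.
  change (a * b * / (r * (r + a + b))) with q.
  replace (r + b + a) with (r + a + b) by ring.
  replace (r * b * a) with (r * a * b) by ring.
  (* With the inradius written as [r * sqrt q], both sides become rational in [sqrt q] and the
     radii. *)
  assert (E : sqrt (r * a * b / (r + a + b)) = r * sqrt q).
  { rewrite <- (sqrt_pow2 r) by lra; rewrite <- sqrt_mult by nra.
    rewrite (sqrt_pow2 r) by lra; f_equal; unfold q; field; lra. }
  rewrite E.
  assert (S : 0 < sqrt q) by now apply sqrt_lt_R0.
  assert (SS : sqrt q * (sqrt q * 1) = q) by (rewrite Rmult_1_r; apply sqrt_sqrt; lra).
  rewrite SS.
  replace (/ (2 * sqrt q)) with (sqrt q / (2 * q))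
    by (rewrite <- SS at 2; field; lra).
  clear E S SS; generalize (sqrt q); intros y; unfold q; field.
  repeat split; try lra; nra.
Qed.

(** Averaging over the segment, instead of picking an intermediate point that depends on the corner,
    keeps the symmetry in [i] and [j]. *)
Definition mean_weight (u w : vertex -> R) (i j k : vertex) : R :=
  RInt (fun t => edge_weight (exp (u i + t * w i)) (exp (u j + t * w j))
                   (exp (u k + t * w k))) 0 1.

Lemma mean_weight_sym u w i j k : mean_weight u w i j k = mean_weight u w j i k.
Proof. apply RInt_ext; intros t _; apply edge_weight_sym. Qed.

Lemma continuous_edge_weight (u0 u1 u2 w0 w1 w2 t : R) :
  continuous (fun t => edge_weight (exp (u0 + t * w0)) (exp (u1 + t * w1))
                         (exp (u2 + t * w2))) t.
Proof.
assert (H0 := exp_pos (u0 + t * w0)); assert (H1 := exp_pos (u1 + t * w1)).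
assert (H2 := exp_pos (u2 + t * w2)).
apply (@ex_derive_continuous R_AbsRing R_NormedModule); unfold edge_weight.
auto_derive; repeat split; try lra.
apply Rdiv_lt_0_compat; repeat apply Rmult_lt_0_compat; lra.
Qed.

Lemma ex_RInt_edge_weight u w (i j k : vertex) :
  ex_RInt (fun t => edge_weight (exp (u i + t * w i)) (exp (u j + t * w j))
                      (exp (u k + t * w k))) 0 1.
Proof.
apply (@ex_RInt_continuous R_CompleteNormedModule); intros t _.
apply continuous_edge_weight.
Qed.

Lemma mean_weight_bounds u w i j k : 0 < mean_weight u w i j k <= 1.
Proof.
split.
- apply RInt_gt_0; [lra| |].
  + intros t _; apply edge_weight_bounds; apply exp_pos.
  + intros t _; apply continuous_edge_weight.
- replace 1 with (RInt (fun _ => 1) 0 1)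
    by (rewrite RInt_const; unfold scal; simpl; unfold mult; simpl; lra).
  apply RInt_le; [lra|apply ex_RInt_edge_weight|apply ex_RInt_const|].
  intros t _; apply edge_weight_bounds; apply exp_pos.
Qed.

(** The fundamental theorem of calculus along the segment from [u] to [u + w]. *)
Lemma corner_angle_diff u w (i j k : vertex) :
  corner_angle (exp (u i + w i)) (exp (u j + w j)) (exp (u k + w k))
  - corner_angle (exp (u i)) (exp (u j)) (exp (u k)) =
  (w j - w i) * mean_weight u w i j k + (w k - w i) * mean_weight u w i k j.
Proof.
assert (D := is_derive_corner_angle (u i) (u j) (u k) (w i) (w j) (w k)).
set (g := fun t => corner_angle (exp (u i + t * w i)) (exp (u j + t * w j))
                     (exp (u k + t * w k))) in D.
set (F1 := fun t => edge_weight (exp (u i + t * w i)) (exp (u j + t * w j))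
                      (exp (u k + t * w k))).
set (F2 := fun t => edge_weight (exp (u i + t * w i)) (exp (u k + t * w k))
                      (exp (u j + t * w j))).
assert (I : is_RInt (fun t => (w j - w i) * F1 t + (w k - w i) * F2 t) 0 1
              (minus (g 1) (g 0))).
{ apply (is_RInt_derive g); intros t _; [apply D|].
  apply (continuous_plus (fun t => (w j - w i) * F1 t) (fun t => (w k - w i) * F2 t)).
  - apply (continuous_scal_r (w j - w i) F1), continuous_edge_weight.
  - apply (continuous_scal_r (w k - w i) F2), continuous_edge_weight. }
assert (J : is_RInt (fun t => (w j - w i) * F1 t + (w k - w i) * F2 t) 0 1
              ((w j - w i) * mean_weight u w i j k
               + (w k - w i) * mean_weight u w i k j)).
{ apply (is_RInt_plus (fun t => (w j - w i) * F1 t) (fun t => (w k - w i) * F2 t)).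
  - apply (is_RInt_scal F1), (@RInt_correct R_CompleteNormedModule).
    apply ex_RInt_edge_weight.
  - apply (is_RInt_scal F2), (@RInt_correct R_CompleteNormedModule).
    apply ex_RInt_edge_weight. }
rewrite <- (is_RInt_unique _ _ _ _ J), (is_RInt_unique _ _ _ _ I).
unfold g, minus, plus, opp; simpl.
now rewrite !Rmult_1_l, !Rmult_0_l, !Rplus_0_r.
Qed.

(** * Sums over centred boxes *)

Fixpoint sumZ (f : Z -> R) (N : nat) : R :=
  match N with
  | O => f 0%Z
  | S N => sumZ f N + f (Z.of_nat (S N)) + f (- Z.of_nat (S N))%Z
  end.

Definition box (f : Z -> Z -> R) (N : nat) : R :=
  sumZ (fun m => sumZ (f m) N) N.

Lemma sumZ_le f g N : (forall m, f m <= g m) -> sumZ f N <= sumZ g N.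
Proof.
intros H; induction N as [|N IH]; simpl; [apply H|].
repeat apply Rplus_le_compat; trivial; apply H.
Qed.

Lemma sumZ_ext f g N : (forall m, f m = g m) -> sumZ f N = sumZ g N.
Proof.
intros H; induction N as [|N IH]; simpl; [apply H|]; now rewrite IH, !H.
Qed.

Lemma sumZ_plus f g N : sumZ (fun m => f m + g m) N = sumZ f N + sumZ g N.
Proof. induction N as [|N IH]; simpl; [easy|]; rewrite IH; ring. Qed.

Lemma sumZ_scal c f N : sumZ (fun m => c * f m) N = c * sumZ f N.
Proof. induction N as [|N IH]; simpl; [easy|]; rewrite IH; ring. Qed.

Lemma sumZ_ge_0 f N : (forall m, 0 <= f m) -> 0 <= sumZ f N.
Proof.
intros H; induction N as [|N IH]; simpl; [apply H|].
repeat apply Rplus_le_le_0_compat; trivial.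
Qed.

Lemma sumZ_ge_term f N : (forall m, 0 <= f m) -> f 0%Z <= sumZ f N.
Proof.
intros H; induction N as [|N IH]; simpl; [lra|].
assert (H1 := H (Z.of_nat (S N))); assert (H2 := H (- Z.of_nat (S N))%Z).
simpl in *; lra.
Qed.

Lemma sumZ_succ f N :
  sumZ (fun m => f (m + 1)%Z) N
  = sumZ f N + f (Z.of_nat N + 1)%Z - f (- Z.of_nat N)%Z.
Proof.
induction N as [|N IH]; [simpl; ring|].
cbn [sumZ]; rewrite IH.
replace (- Z.of_nat (S N) + 1)%Z with (- Z.of_nat N)%Z by lia.
replace (Z.of_nat N + 1)%Z with (Z.of_nat (S N)) by lia; ring.
Qed.

(** Vanishing starts at [Z.abs m = N], since a shift by one moves an end term out of the range. *)
Lemma sumZ_shift f N p :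
  (-1 <= p <= 1)%Z -> (forall m, (Z.of_nat N <= Z.abs m)%Z -> f m = 0) ->
  sumZ (fun m => f (m + p)%Z) N = sumZ f N.
Proof.
intros Hp H.
assert (C : (p = -1 \/ p = 0 \/ p = 1)%Z) by lia.
destruct C as [Ep|[Ep|Ep]]; subst p.
- assert (E := sumZ_succ (fun m => f (m + -1)%Z) N); simpl in E.
  rewrite (H (- _ + _)%Z), (H (_ + 1 + _)%Z) in E by lia.
  rewrite Rplus_0_r, Rminus_0_r in E; rewrite <- E.
  apply sumZ_ext; intros m; f_equal; lia.
- apply sumZ_ext; intros m; f_equal; lia.
- rewrite sumZ_succ, !H by lia; ring.
Qed.

Lemma box_le f g N : (forall m n, f m n <= g m n) -> box f N <= box g N.
Proof. intros H; apply sumZ_le; intros m; now apply sumZ_le. Qed.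

Lemma box_ext f g N : (forall m n, f m n = g m n) -> box f N = box g N.
Proof. intros H; apply sumZ_ext; intros m; now apply sumZ_ext. Qed.

Lemma box_plus f g N : box (fun m n => f m n + g m n) N = box f N + box g N.
Proof.
unfold box; rewrite <- sumZ_plus; apply sumZ_ext; intros m; apply sumZ_plus.
Qed.

Lemma box_scal c f N : box (fun m n => c * f m n) N = c * box f N.
Proof.
unfold box; rewrite <- sumZ_scal; apply sumZ_ext; intros m; apply sumZ_scal.
Qed.

Lemma box_ge_term f N : (forall m n, 0 <= f m n) -> f 0%Z 0%Z <= box f N.
Proof.
intros H; apply Rle_trans with (sumZ (f 0%Z) N); [now apply sumZ_ge_term|].
apply (sumZ_ge_term (fun m => sumZ (f m) N)); intros m; now apply sumZ_ge_0.
Qed.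

Lemma box_shift f N p q :
  (-1 <= p <= 1)%Z -> (-1 <= q <= 1)%Z ->
  (forall m n, (Z.of_nat N <= Z.abs m \/ Z.of_nat N <= Z.abs n)%Z -> f m n = 0) ->
  box (fun m n => f (m + p)%Z (n + q)%Z) N = box f N.
Proof.
intros Hp Hq H; unfold box.
rewrite <- (sumZ_shift (fun m => sumZ (f m) N) N p Hp).
- apply sumZ_ext; intros m; apply sumZ_shift; auto.
- intros m Hm; rewrite (sumZ_ext _ (fun _ => 0 * 0)), sumZ_scal; [ring|].
  intros n; rewrite H; [ring|auto].
Qed.

(** * Energy estimates with a cutoff *)

(* With [h] the mean of [eta], the product rule reads
   [d(eta^2 w) dw = (h^2 + (d eta)^2 / 4) dw^2 + 2 h (d eta) (mean w) dw]. *)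
Lemma cutoff_edge_bound B w0 w1 e0 e1 :
  Rabs w0 <= B -> Rabs w1 <= B ->
  ((e0 + e1) / 2)² * (w1 - w0)² / 2 - 2 * B² * (e1 - e0)²
    <= (w1 - w0) * (e1² * w1 - e0² * w0).
Proof.
intros H0 H1.
set (h := (e0 + e1) / 2); set (W := (w0 + w1) / 2).
assert (HW : W² <= B²).
{ apply Rsqr_le_abs_1; apply Rabs_le_between in H0; apply Rabs_le_between in H1.
  rewrite (Rabs_pos_eq B) by lra; apply Rabs_le; unfold W; lra. }
assert (E : (w1 - w0) * (e1² * w1 - e0² * w0) =
  h² * (w1 - w0)² + (e1 - e0)² * (w1 - w0)² / 4
  + 2 * h * (e1 - e0) * W * (w1 - w0)) by (unfold h, W, Rsqr; field).
rewrite E.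
assert (Q : 0 <= (h * (w1 - w0) + 2 * (e1 - e0) * W)²) by apply Rle_0_sqr.
assert (Q1 : 0 <= (e1 - e0)² * (w1 - w0)²)
  by (apply Rmult_le_pos; apply Rle_0_sqr).
assert (Q2 : (e1 - e0)² * W² <= (e1 - e0)² * B²)
  by (apply Rmult_le_compat_l; [apply Rle_0_sqr|easy]).
unfold Rsqr in *; nra.
Qed.

(** [flux c w p q] is the flow along the edges in direction [(p, q)] for the
    potential [w] and the conductances [c], where [c m n] belongs to the edge
    from [(m, n)] to [(m + p, n + q)]. *)
Definition flux (c w : Z -> Z -> R) (p q m n : Z) : R :=
  c m n * (w (m + p)%Z (n + q)%Z - w m n).

(** Net outflow through the two edges parallel to [(p, q)]; the incoming edge is indexed by its
    tail. *)
Definition div (c w : Z -> Z -> R) (p q m n : Z) : R :=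
  flux c w p q m n - flux c w p q (m - p) (n - q).

(** A Caccioppoli inequality: the divergence is tested against [eta^2 w], summed by parts and
    estimated edge by edge. It stays in the statement because only its sum over the three directions
    will vanish. *)
Lemma direction_energy (c w eta g : Z -> Z -> R) B K p q N :
  (-1 <= p <= 1)%Z -> (-1 <= q <= 1)%Z ->
  (forall m n, 0 < c m n <= K) -> (forall m n, Rabs (w m n) <= B) ->
  (forall m n, (Z.of_nat N <= Z.abs m \/ Z.of_nat N <= Z.abs n)%Z ->
     eta m n = 0) ->
  (forall m n, (eta (m + p)%Z (n + q)%Z - eta m n)² <= g m n) ->
  c 0%Z 0%Z * (((eta 0%Z 0%Z + eta p q) / 2)² * (w p q - w 0%Z 0%Z)² / 2)
  + box (fun m n => (eta m n)² * w m n * div c w p q m n) N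
    <= 2 * B² * K * box g N.
Proof.
intros Hp Hq Hc Hw He Hg.
set (phi := fun m n => (eta m n)² * w m n).
set (E := fun m n => c m n * (((eta m n + eta (m + p)%Z (n + q)%Z) / 2)²
                              * (w (m + p)%Z (n + q)%Z - w m n)² / 2)).
(* Of the nonnegative energy only the edge leaving the origin is kept. *)
assert (E0 : E 0%Z 0%Z <= box E N).
{ apply box_ge_term; intros m n; unfold E.
  apply Rmult_le_pos; [apply Rlt_le, Hc|].
  apply Rdiv_le_0_compat; [apply Rmult_le_pos; apply Rle_0_sqr|lra]. }
unfold E at 1 in E0; rewrite !Z.add_0_l in E0.
(* No boundary term arises, as [phi] vanishes at the rim of the box and beyond. *)
assert (P : box (fun m n => phi m n * flux c w p q (m - p) (n - q)) N
            = box (fun m n => phi (m + p)%Z (n + q)%Z * flux c w p q m n) N).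
{ rewrite <- (box_shift (fun m n => phi m n * flux c w p q (m - p) (n - q)) N p q);
    trivial.
  - apply box_ext; intros m n; do 2 f_equal; lia.
  - intros m n Hmn; unfold phi; rewrite He by easy; unfold Rsqr; ring. }
assert (D : box (fun m n => phi m n * div c w p q m n) N
            = - box (fun m n => (phi (m + p)%Z (n + q)%Z - phi m n)
                                * flux c w p q m n) N).
{ rewrite (box_ext _ (fun m n => phi m n * flux c w p q m n
      + (-1) * (phi m n * flux c w p q (m - p) (n - q))))
    by (intros m n; unfold div; ring).
  rewrite box_plus, box_scal, P.
  rewrite (box_ext (fun m n => (phi (m + p)%Z (n + q)%Z - phi m n) * _)
     (fun m n => phi (m + p)%Z (n + q)%Z * flux c w p q m n
      + (-1) * (phi m n * flux c w p q m n)))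
    by (intros m n; ring).
  rewrite box_plus, box_scal; ring. }
assert (L : box (fun m n => E m n + (- (2 * B² * K)) * g m n) N
   <= box (fun m n => (phi (m + p)%Z (n + q)%Z - phi m n) * flux c w p q m n) N).
{ apply box_le; intros m n; unfold phi, flux, E.
  assert (Q := cutoff_edge_bound B (w m n) (w (m + p)%Z (n + q)%Z) (eta m n)
                 (eta (m + p)%Z (n + q)%Z) (Hw _ _) (Hw _ _)).
  specialize (Hc m n); specialize (Hg m n).
  set (h := (_ / 2)² * _ / 2) in Q |- *.
  set (d := (eta (m + p)%Z (n + q)%Z - eta m n)²) in *.
  set (x := (_ - _) * _) in Q.
  replace (_ * (c m n * _)) with (c m n * x) by (unfold x; ring).
  assert (0 <= B²) by apply Rle_0_sqr.
  assert (0 <= d) by apply Rle_0_sqr.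
  assert (c m n * d <= K * g m n) by (apply Rmult_le_compat; lra).
  assert (B² * (c m n * d) <= B² * (K * g m n)) by (apply Rmult_le_compat_l; lra).
  assert (c m n * (h - 2 * B² * d) <= c m n * x) by (apply Rmult_le_compat_l; lra).
  lra. }
rewrite box_plus, box_scal in L; fold phi; change (fun m n => _ * div c w p q m n)
  with (fun m n => phi m n * div c w p q m n); lra.
Qed.

(** * The logarithmic cutoff and a Liouville theorem *)

Definition norm1 (m n : Z) : R := IZR (Z.abs m + Z.abs n).

(** For [N > 0] it is 1 at the origin and 0 from norm [N] on. A linear profile would only give
    bounded energy, not energy tending to 0. *)
Definition cutoff (N : nat) (m n : Z) : R :=
  Rmax 0 (1 - ln (1 + norm1 m n) / ln (1 + INR N)).

Lemma norm1_ge_0 m n : 0 <= norm1 m n.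
Proof. apply (IZR_le 0); lia. Qed.

(** The distance 2 is the most [norm1] changes along [(1, -1)]. The natural bound is 2 over the
    smaller argument; [1 + y <= 3 * (1 + x)] moves it to [y] and yields 6. *)
Lemma ln_lipschitz x y :
  0 <= x -> 0 <= y -> Rabs (x - y) <= 2 ->
  Rabs (ln (1 + x) - ln (1 + y)) <= 6 / (1 + y).
Proof.
assert (L : forall s t, 0 <= s -> s <= t <= s + 2 ->
          0 <= ln (1 + t) - ln (1 + s) <= 2 / (1 + s)).
{ intros s t Hs Ht; rewrite <- ln_div by lra; split.
  - rewrite <- ln_1; apply ln_le; [lra|].
    apply Rmult_le_reg_r with (1 + s); [lra|].
    unfold Rdiv; rewrite Rmult_assoc, Rinv_l; lra.
  - assert (Q : 0 < (1 + t) / (1 + s)) by (apply Rdiv_lt_0_compat; lra).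
    assert (X := exp_ineq1_le (ln ((1 + t) / (1 + s)))); rewrite exp_ln in X by easy.
    assert (2 / (1 + s) - ((1 + t) / (1 + s) - 1) = (s + 2 - t) / (1 + s))
      by (field; lra).
    assert (0 <= (s + 2 - t) / (1 + s)) by (apply Rdiv_le_0_compat; lra).
    lra. }
intros Hx Hy H; apply Rabs_le_between in H.
destruct (Rle_dec y x).
- specialize (L y x Hy ltac:(lra)); rewrite Rabs_pos_eq by lra.
  assert (6 / (1 + y) = 2 / (1 + y) + 4 / (1 + y)) by (field; lra).
  assert (0 < 4 / (1 + y)) by (apply Rdiv_lt_0_compat; lra); lra.
- specialize (L x y Hx ltac:(lra)); rewrite Rabs_minus_sym, Rabs_pos_eq by lra.
  assert (6 / (1 + y) - 2 / (1 + x) = (4 + 6 * x - 2 * y) / ((1 + x) * (1 + y)))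
    by (field; lra).
  assert (0 <= (4 + 6 * x - 2 * y) / ((1 + x) * (1 + y)))
    by (apply Rdiv_le_0_compat; [lra|apply Rmult_lt_0_compat; lra]).
  lra.
Qed.

Lemma cutoff_gradient N m n p q :
  (0 < N)%nat -> (Z.abs p + Z.abs q <= 2)%Z ->
  (cutoff N (m + p) (n + q) - cutoff N m n)²
    <= 36 / (ln (1 + INR N))² * (1 / (1 + norm1 m n)²).
Proof.
intros HN Hpq; unfold cutoff.
assert (HL : 0 < ln (1 + INR N)).
{ rewrite <- ln_1; apply ln_increasing; [lra|]; apply lt_INR in HN; simpl in HN; lra. }
set (L := ln (1 + INR N)) in *.
assert (Hx := norm1_ge_0 (m + p) (n + q)); assert (Hy := norm1_ge_0 m n).
assert (Hxy : Rabs (norm1 (m + p) (n + q) - norm1 m n) <= 2).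
{ unfold norm1; rewrite <- minus_IZR, <- abs_IZR; apply (IZR_le _ 2); lia. }
set (x := norm1 (m + p) (n + q)) in *; set (y := norm1 m n) in *.
assert (H := ln_lipschitz x y Hx Hy Hxy).
assert (M : forall s t, Rabs (Rmax 0 s - Rmax 0 t) <= Rabs (s - t)).
{ intros s t; unfold Rmax, Rabs; repeat destruct Rle_dec; repeat destruct Rcase_abs; lra. }
replace (36 / L² * (1 / (1 + y)²)) with (6 / (1 + y) / L)²
  by (unfold Rsqr; field; lra).
apply Rsqr_le_abs_1; eapply Rle_trans; [apply M|].
replace (1 - ln (1 + x) / L - (1 - ln (1 + y) / L))
  with (- ((ln (1 + x) - ln (1 + y)) * / L)) by (field; lra).
assert (0 < / L) by now apply Rinv_0_lt_compat.
rewrite Rabs_Ropp, Rabs_mult, (Rabs_pos_eq (/ L)) by lra.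
rewrite (Rabs_pos_eq (6 / (1 + y) / L)).
- apply Rmult_le_compat_r; lra.
- apply Rlt_le; repeat apply Rdiv_lt_0_compat; lra.
Qed.

(** The terms at [n] and [-n] are dominated by a telescoping difference; the subtracted fraction
    makes the induction pass. *)
Lemma sum_inverse_square k N :
  0 <= k ->
  sumZ (fun n => 1 / (1 + (k + IZR (Z.abs n)))²) N
    <= 4 * (1 / (1 + k) - 1 / (2 + k + INR N)).
Proof.
intros Hk; unfold Rsqr; induction N as [|N IH].
- simpl; rewrite !Rplus_0_r.
  assert (4 * (1 / (1 + k) - 1 / (2 + k)) - 1 / ((1 + k) * (1 + k))
          = (2 + 3 * k) / ((1 + k) * (1 + k) * (2 + k))) by (field; lra).
  assert (0 <= (2 + 3 * k) / ((1 + k) * (1 + k) * (2 + k))).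
  { apply Rdiv_le_0_compat; [lra|]; repeat apply Rmult_lt_0_compat; lra. }
  lra.
- cbn [sumZ]; rewrite Z.abs_opp, Z.abs_eq, <- INR_IZR_INZ, S_INR by lia.
  assert (HN := pos_INR N); set (x := INR N) in *.
  assert (4 * (1 / (2 + k + x) - 1 / (2 + k + (x + 1)))
          - 2 * (1 / ((1 + (k + (x + 1))) * (1 + (k + (x + 1)))))
          = (2 * (1 + k + x)) / ((2 + k + x) * (2 + k + x) * (3 + k + x)))
    by (field; lra).
  assert (0 <= (2 * (1 + k + x)) / ((2 + k + x) * (2 + k + x) * (3 + k + x))).
  { apply Rdiv_le_0_compat; [lra|]; repeat apply Rmult_lt_0_compat; lra. }
  lra.
Qed.

(** Each term is at most an increment of the logarithm, by [1 + t <= exp t]. *)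
Lemma sum_inverse N :
  sumZ (fun m => 1 / (1 + IZR (Z.abs m))) N <= 2 * (1 + ln (1 + INR N)).
Proof.
induction N as [|N IH].
- simpl; rewrite Rplus_0_r, ln_1; lra.
- cbn [sumZ]; rewrite Z.abs_opp, Z.abs_eq, <- INR_IZR_INZ, S_INR by lia.
  assert (HN := pos_INR N); set (x := INR N) in *.
  assert (Q : 0 < (1 + x) / (1 + (x + 1))) by (apply Rdiv_lt_0_compat; lra).
  assert (X := exp_ineq1_le (ln ((1 + x) / (1 + (x + 1))))).
  rewrite exp_ln, ln_div in X by lra.
  assert (1 / (1 + (x + 1)) = 1 - (1 + x) / (1 + (x + 1))) by (field; lra).
  lra.
Qed.

(** Row [m] contributes at most [4 / (1 + |m|)], leaving a harmonic sum. In the cutoff energy its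
    single logarithm is divided by a squared one. *)
Lemma box_inverse_square N :
  box (fun m n => 1 / (1 + norm1 m n)²) N <= 8 * (1 + ln (1 + INR N)).
Proof.
assert (S := sum_inverse N).
apply Rle_trans with (sumZ (fun m => 4 * (1 / (1 + IZR (Z.abs m)))) N).
- apply sumZ_le; intros m.
  assert (Hm : 0 <= IZR (Z.abs m)) by (apply (IZR_le 0); lia).
  assert (T := sum_inverse_square (IZR (Z.abs m)) N Hm).
  rewrite (sumZ_ext _ (fun n => 1 / (1 + (IZR (Z.abs m) + IZR (Z.abs n)))²))
    by (intros n; unfold norm1; now rewrite plus_IZR).
  assert (0 < 1 / (2 + IZR (Z.abs m) + INR N)).
  { assert (HN := pos_INR N); apply Rdiv_lt_0_compat; lra. }
  lra.
- rewrite sumZ_scal; lra.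
Qed.

Lemma cutoff_support N m n :
  (0 < N)%nat -> (Z.of_nat N <= Z.abs m \/ Z.of_nat N <= Z.abs n)%Z ->
  cutoff N m n = 0.
Proof.
intros HN H; apply Rmax_left.
assert (HL : 0 < ln (1 + INR N)).
{ rewrite <- ln_1; apply ln_increasing; [lra|]; apply lt_INR in HN; simpl in HN; lra. }
assert (INR N <= norm1 m n) by (rewrite INR_IZR_INZ; apply IZR_le; lia).
assert (P := pos_INR N).
assert (ln (1 + INR N) <= ln (1 + norm1 m n)) by (apply ln_le; lra).
assert (1 <= ln (1 + norm1 m n) / ln (1 + INR N)).
{ apply Rmult_le_reg_r with (ln (1 + INR N)); [easy|].
  unfold Rdiv; rewrite Rmult_assoc, Rinv_l; lra. }
lra.
Qed.

(** Proved only at the origin, the general case following by translation. The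
    logarithmic cutoff at radius [N] has energy [O(1 / ln N)]. *)
Lemma bounded_harmonic_constant (c1 c2 c3 w : Z -> Z -> R) B K :
  (forall m n, 0 < c1 m n <= K) -> (forall m n, 0 < c2 m n <= K) ->
  (forall m n, 0 < c3 m n <= K) -> (forall m n, Rabs (w m n) <= B) ->
  (forall m n, div c1 w 1 0 m n + div c2 w 0 1 m n + div c3 w 1 (-1) m n = 0) ->
  w 1%Z 0%Z = w 0%Z 0%Z /\ w 0%Z 1%Z = w 0%Z 0%Z.
Proof.
intros H1 H2 H3 Hw Hh.
assert (HK : 0 < K) by (specialize (H1 0 0)%Z; lra).
assert (HB : 0 <= B²) by apply Rle_0_sqr.
assert (bound : forall N, (0 < N)%nat -> 1 <= ln (1 + INR N) ->
  c1 0%Z 0%Z * (w 1%Z 0%Z - w 0%Z 0%Z)² + c2 0%Z 0%Z * (w 0%Z 1%Z - w 0%Z 0%Z)²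
  <= 8 * (6 * B² * K * 576) / ln (1 + INR N)).
{ intros N HN HL; set (L := ln (1 + INR N)) in *.
  set (g := fun m n => 36 / L² * (1 / (1 + norm1 m n)²)).
  (* Since [1 <= L], [8 * (1 + L) <= 16 * L], and [576 = 36 * 16]. *)
  assert (G : box g N <= 576 / L).
  { unfold g; rewrite box_scal; assert (S := box_inverse_square N); fold L in S.
    apply Rle_trans with (36 / L² * (8 * (1 + L))).
    - apply Rmult_le_compat_l; [|easy].
      apply Rdiv_le_0_compat; [lra|unfold Rsqr; nra].
    - assert (576 / L - 36 / L² * (8 * (1 + L)) = 288 * (L - 1) / L²)
        by (unfold Rsqr; field; lra).
      assert (0 <= 288 * (L - 1) / L²)
        by (apply Rdiv_le_0_compat; [lra|unfold Rsqr; nra]).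
      lra. }
  assert (C := fun m n => cutoff_support N m n HN).
  assert (Hg := fun p q H m n => cutoff_gradient N m n p q HN H).
  assert (D1 := direction_energy c1 w (cutoff N) g B K 1 0 N ltac:(lia) ltac:(lia)
                  H1 Hw C (Hg 1 0 ltac:(lia))%Z).
  assert (D2 := direction_energy c2 w (cutoff N) g B K 0 1 N ltac:(lia) ltac:(lia)
                  H2 Hw C (Hg 0 1 ltac:(lia))%Z).
  assert (D3 := direction_energy c3 w (cutoff N) g B K 1 (-1) N ltac:(lia) ltac:(lia)
                  H3 Hw C (Hg 1 (-1) ltac:(lia))%Z).
  (* Harmonicity cancels the divergence terms of the three directions. *)
  assert (Z : box (fun m n => (cutoff N m n)² * w m n * div c1 w 1 0 m n) N
    + box (fun m n => (cutoff N m n)² * w m n * div c2 w 0 1 m n) N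
    + box (fun m n => (cutoff N m n)² * w m n * div c3 w 1 (-1) m n) N = 0).
  { rewrite <- !box_plus.
    rewrite (box_ext _ (fun _ _ => 0 * 0)), box_scal; [ring|].
    intros m n; rewrite <- !Rmult_plus_distr_l, Hh; ring. }
  assert (eta0 : cutoff N 0 0 = 1).
  { unfold cutoff, norm1; simpl; rewrite Rplus_0_r, ln_1.
    unfold Rdiv; rewrite Rmult_0_l, Rminus_0_r; apply Rmax_right; lra. }
  (* The mean of the cutoff along an edge at the origin is at least [1 / 2], whence the factor 8. *)
  assert (half : forall p q x, 0 <= x ->
    x / 8 <= ((cutoff N 0 0 + cutoff N p q) / 2)² * x / 2).
  { intros p q x Hx; rewrite eta0.
    assert (0 <= cutoff N p q) by apply Rmax_l.
    assert (/ 4 <= ((1 + cutoff N p q) / 2)²) by (unfold Rsqr; nra).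
    nra. }
  assert (A1 := Rmult_le_compat_l (c1 0 0)%Z _ _ ltac:(apply Rlt_le, H1)
    (half 1%Z 0%Z _ (Rle_0_sqr (w 1%Z 0%Z - w 0%Z 0%Z)))).
  assert (A2 := Rmult_le_compat_l (c2 0 0)%Z _ _ ltac:(apply Rlt_le, H2)
    (half 0%Z 1%Z _ (Rle_0_sqr (w 0%Z 1%Z - w 0%Z 0%Z)))).
  assert (A3 := Rmult_le_compat_l (c3 0 0)%Z _ _ ltac:(apply Rlt_le, H3)
    (half 1%Z (-1)%Z _ (Rle_0_sqr (w 1%Z (-1)%Z - w 0%Z 0%Z)))).
  assert (0 <= c3 0%Z 0%Z * ((w 1%Z (-1)%Z - w 0%Z 0%Z)² / 8)).
  { apply Rmult_le_pos; [apply Rlt_le, H3|].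
    assert (P := Rle_0_sqr (w 1%Z (-1)%Z - w 0%Z 0%Z)); lra. }
  assert (HBK : 0 <= B² * K) by (apply Rmult_le_pos; lra).
  assert (2 * B² * K * box g N <= 2 * B² * K * (576 / L))
    by (apply Rmult_le_compat_l; [lra|easy]).
  replace (8 * (6 * B² * K * 576) / L) with (8 * (3 * (2 * B² * K * (576 / L))))
    by (field; lra).
  lra. }
assert (Q1 := Rle_0_sqr (w 1%Z 0%Z - w 0%Z 0%Z)).
assert (Q2 := Rle_0_sqr (w 0%Z 1%Z - w 0%Z 0%Z)).
specialize (H1 0%Z 0%Z); specialize (H2 0%Z 0%Z).
set (X := c1 0%Z 0%Z * (w 1%Z 0%Z - w 0%Z 0%Z)²
          + c2 0%Z 0%Z * (w 0%Z 1%Z - w 0%Z 0%Z)²) in *.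
set (C := 8 * (6 * B² * K * 576)) in *.
assert (HX : X <= 0).
{ apply Rnot_lt_le; intros HX.
  (* As [l] exceeds [C / X], any [N > exp l] violates [X * ln (1 + INR N) <= C]. *)
  set (l := 1 + Rmax 0 (C / X)).
  assert (Hl : 1 <= l) by (unfold l; assert (M := Rmax_l 0 (C / X)); lra).
  destruct (archimed_cor1 (/ exp l)) as [N [HN1 HN2]].
  { apply Rinv_0_lt_compat, exp_pos. }
  assert (HN3 : 0 < INR N) by now apply (lt_INR 0).
  assert (HN4 : exp l < INR N).
  { apply Rinv_lt_cancel; [easy|]; easy. }
  assert (HN5 : l <= ln (1 + INR N)).
  { rewrite <- (ln_exp l); apply ln_le; [apply exp_pos|lra]. }
  specialize (bound N HN2 ltac:(lra)).
  assert (X * ln (1 + INR N) <= C).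
  { replace C with (C / ln (1 + INR N) * ln (1 + INR N)) by (field; lra).
    apply Rmult_le_compat_r; lra. }
  assert (X * (C / X) = C) by (field; lra).
  assert (C / X <= l - 1) by (unfold l; assert (M := Rmax_r 0 (C / X)); lra).
  nra. }
assert (P1 : 0 <= c1 0%Z 0%Z * (w 1%Z 0%Z - w 0%Z 0%Z)²) by nra.
assert (P2 : 0 <= c2 0%Z 0%Z * (w 0%Z 1%Z - w 0%Z 0%Z)²) by nra.
split; apply Rminus_diag_uniq, Rsqr_0_uniq; unfold X in *; nra.
Qed.

(** * From packings to flowers *)

(** The unit steps in counterclockwise order; the last clause makes the sequence 6-periodic by
    computation. *)
Fixpoint dir (k : nat) : vertex :=
  match k with
  | 0%nat => (1, 0) | 1%nat => (0, 1) | 2%nat => (-1, 1)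
  | 3%nat => (-1, 0) | 4%nat => (0, -1) | 5%nat => (1, -1)
  | S (S (S (S (S (S k))))) => dir k
  end%Z.

Definition add (v d : vertex) : vertex := ((fst v + fst d)%Z, (snd v + snd d)%Z).

Lemma dir_ind (Q : nat -> Prop) :
  Q 0%nat -> Q 1%nat -> Q 2%nat -> Q 3%nat -> Q 4%nat -> Q 5%nat ->
  (forall k, Q k -> Q (6 + k)%nat) -> forall k, Q k.
Proof.
intros Q0 Q1 Q2 Q3 Q4 Q5 H; induction k as [k IH] using lt_wf_ind.
destruct (le_lt_dec 6 k) as [L|L].
- replace k with (6 + (k - 6))%nat by lia; apply H, IH; lia.
- do 6 (destruct k as [|k]; [easy|]); lia.
Qed.

Lemma hex_edge_dir v k : hex_edge v (add v (dir k)).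
Proof.
destruct v as [m n].
induction k using dir_ind; [..|exact IHk]; apply hex_edgeE; simpl;
  rewrite !pair_equal_spec; lia.
Qed.

Lemma hex_edge_dir_succ v k : hex_edge (add v (dir k)) (add v (dir (S k))).
Proof.
destruct v as [m n].
induction k using dir_ind; [..|exact IHk]; apply hex_edgeE; simpl;
  rewrite !pair_equal_spec; lia.
Qed.

Lemma hex_edge_sym v w : hex_edge v w -> hex_edge w v.
Proof.
unfold hex_edge; intros H; rewrite <- H, <- Cmod_opp; f_equal; ring.
Qed.

Lemma ccw_dir v k :
  ccw (hex_point v) (hex_point (add v (dir k))) (hex_point (add v (dir (S k)))).
Proof.
destruct v as [m n].
assert (S : 0 < sqrt 3) by (apply sqrt_lt_R0; lra).
induction k using dir_ind; [..|exact IHk];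
  unfold ccw, hex_point, expi; simpl; rewrite cos_PI3, sin_PI3, !plus_IZR; simpl;
  nra.
Qed.

Lemma hex_positive_face_dir v k :
  hex_positive_face v (add v (dir k)) (add v (dir (S k))).
Proof.
repeat split; [apply hex_edge_dir|apply hex_edge_dir_succ| |apply ccw_dir].
apply hex_edge_sym, hex_edge_dir.
Qed.

Lemma dir_neq k n : (0 < n < 6)%nat -> dir (n + k) <> dir k.
Proof.
intros Hn.
assert (C : (n = 1 \/ n = 2 \/ n = 3 \/ n = 4 \/ n = 5)%nat) by lia.
revert k; destruct C as [E|[E|[E|[E|E]]]]; subst n;
  induction k using dir_ind; easy.
Qed.

(** Otherwise the point dividing the segment of centres in proportion to the radii lies in both
    disks. *)
Lemma disjoint_interiors_dist K L :
  0 < radius K -> 0 < radius L -> disjoint_interiors K L ->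
  radius K + radius L <= Cmod (center L - center K).
Proof.
intros HK HL H; apply Rnot_lt_le; intros D.
set (d := Cmod (center L - center K)) in *.
set (s := radius K / (radius K + radius L)).
apply (H (center K + s * (center L - center K))%C).
assert (Hs : 0 < s) by (apply Rdiv_lt_0_compat; lra).
assert (Hs1 : s * (radius K + radius L) = radius K) by (unfold s; field; lra).
unfold open_disk; split.
- replace (_ - _)%C with (s * (center L - center K))%C by ring.
  rewrite Cmod_mult, Cmod_R, Rabs_pos_eq by lra; fold d; nra.
- replace (_ - _)%C with (- ((1 - s)%R * (center L - center K)))%C
    by (rewrite RtoC_minus; ring).
  assert (0 < 1 - s) by nra.
  rewrite Cmod_opp, Cmod_mult, Cmod_R, Rabs_pos_eq by lra; fold d; nra.
Qed.

(** Coordinates are relative to the central circle. Unit vectors towards consecutive petals differ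
    by a rotation through the corner angle, so [turning] is the true angle between petals, which
    gives closure. *)
Lemma flower_of_centres (r : R) (a x y : nat -> R) :
  0 < r -> (forall k, 0 < a k) ->
  (forall k, a (6 + k)%nat = a k /\ x (6 + k)%nat = x k /\ y (6 + k)%nat = y k) ->
  (forall k, (x k)² + (y k)² = (r + a k)²) ->
  (forall k, (x (S k) - x k)² + (y (S k) - y k)² = (a k + a (S k))²) ->
  (forall k, 0 < x k * y (S k) - y k * x (S k)) ->
  (forall k n, (0 < n < 6)%nat ->
     (a k + a (n + k)%nat)² <= (x (n + k)%nat - x k)² + (y (n + k)%nat - y k)²) ->
  flower r a.
Proof.
intros Hr Ha Hper Hlen Hadj Hcross Hdisj.
set (X := fun k => x k / (r + a k)); set (Y := fun k => y k / (r + a k)).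
assert (ra : forall k, 0 < r + a k) by (intros k; specialize (Ha k); lra).
assert (unit : forall k, X k * X k + Y k * Y k = 1).
{ intros k; unfold X, Y; specialize (Hlen k); specialize (ra k); unfold Rsqr in *.
  replace (x k / (r + a k) * (x k / (r + a k)) + y k / (r + a k) * (y k / (r + a k)))
    with ((x k * x k + y k * y k) / ((r + a k) * (r + a k))) by (field; lra).
  rewrite Hlen; field; lra. }
(* The law of cosines with a defect term: zero for tangent petals, at most zero for disjoint
   ones. *)
assert (dot : forall j k, X j * X k + Y j * Y k
  = cos (corner_angle r (a j) (a k))
    + ((a j + a k)² - ((x k - x j)² + (y k - y j)²)) / (2 * (r + a j) * (r + a k))).
{ intros j k; rewrite cos_corner_angle by auto; unfold X, Y.
  assert (Lj := Hlen j); assert (Lk := Hlen k).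
  assert (Rj := ra j); assert (Rk := ra k); unfold Rsqr in *.
  apply Rmult_eq_reg_r with (2 * (r + a j) * (r + a k)); [|nra].
  field_simplify; lra. }
assert (dot1 : forall k, X k * X (S k) + Y k * Y (S k)
                         = cos (corner_angle r (a k) (a (S k)))).
{ intros k; rewrite dot, Hadj; field.
  split; apply Rgt_not_eq, ra. }
(* Orientation fixes the sign, so it suffices to compare squares, by Lagrange's identity. *)
assert (cross1 : forall k, X k * Y (S k) - Y k * X (S k)
                         = sin (corner_angle r (a k) (a (S k)))).
{ intros k; destruct (corner_angle_bounds r (a k) (a (S k)) Hr (Ha _) (Ha _)) as [L1 L2].
  apply Rsqr_inj.
  - replace (X k * Y (S k) - Y k * X (S k)) with
      ((x k * y (S k) - y k * x (S k)) / ((r + a k) * (r + a (S k)))).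
    + apply Rlt_le, Rdiv_lt_0_compat; [apply Hcross|].
      apply Rmult_lt_0_compat; apply ra.
    + unfold X, Y; field; split; apply Rgt_not_eq, ra.
  - apply sin_ge_0; lra.
  - rewrite sin2, <- dot1; assert (U := unit k); assert (U' := unit (S k)).
    unfold Rsqr.
    transitivity ((X k * X k + Y k * Y k) * (X (S k) * X (S k) + Y (S k) * Y (S k))
      - (X k * X (S k) + Y k * Y (S k)) * (X k * X (S k) + Y k * Y (S k))); [ring|].
    rewrite U, U'; ring. }
assert (rot1 : forall k (t := corner_angle r (a k) (a (S k))),
  X (S k) = cos t * X k - sin t * Y k /\ Y (S k) = sin t * X k + cos t * Y k).
{ intros k t; unfold t; rewrite <- dot1, <- cross1; assert (U := unit k); split.
  - transitivity (X (S k) * (X k * X k + Y k * Y k)); [rewrite U; ring|ring].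
  - transitivity (Y (S k) * (X k * X k + Y k * Y k)); [rewrite U; ring|ring]. }
assert (rot : forall k n (t := turning r a k n),
  X (n + k)%nat = cos t * X k - sin t * Y k
  /\ Y (n + k)%nat = sin t * X k + cos t * Y k).
{ intros k n; induction n as [|n [IX IY]]; cbn [turning]; cbn zeta.
  - change (0 + k)%nat with k; rewrite cos_0, sin_0; split; ring.
  - destruct (rot1 (n + k)%nat) as [RX RY].
    change (S n + k)%nat with (S (n + k)); rewrite cos_plus, sin_plus,
      RX, RY, IX, IY; split; ring. }
assert (cosT : forall k n, cos (turning r a k n)
                           = X k * X (n + k)%nat + Y k * Y (n + k)%nat).
{ intros k n; destruct (rot k n) as [RX RY]; assert (U := unit k).
  rewrite RX, RY.
  transitivity (cos (turning r a k n) * (X k * X k + Y k * Y k)); [rewrite U|]; ring. }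
assert (sinT : forall k n, sin (turning r a k n)
                           = X k * Y (n + k)%nat - Y k * X (n + k)%nat).
{ intros k n; destruct (rot k n) as [RX RY]; assert (U := unit k).
  rewrite RX, RY.
  transitivity (sin (turning r a k n) * (X k * X k + Y k * Y k)); [rewrite U|]; ring. }
split; trivial.
- intros k; apply Hper.
- intros k; rewrite cosT, sinT.
  destruct (Hper k) as [E1 [E2 E3]]; unfold X, Y; rewrite E1, E2, E3; fold (X k) (Y k).
  split; [apply unit|ring].
- intros k n Hn; rewrite cosT, dot.
  assert (D := Hdisj k n Hn).
  assert (Q : 0 < 2 * (r + a k) * (r + a (n + k)%nat)).
  { assert (R1 := ra k); assert (R2 := ra (n + k)%nat); nra. }
  apply Rinv_0_lt_compat in Q; unfold Rdiv; nra.
Qed.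

Lemma Cmod_sqr (z : C) : (Cmod z)² = (fst z)² + (snd z)².
Proof.
unfold Cmod; rewrite Rsqr_sqrt; [unfold Rsqr; ring|nra].
Qed.

Lemma packing_flower P v :
  circle_packing P -> univalent_flowers P ->
  flower (radius (P v)) (fun k => radius (P (add v (dir k)))).
Proof.
intros [Hpos [Htan Hor]] Huni.
assert (T : forall v w, hex_edge v w ->
  (fst (center (P w)) - fst (center (P v)))² + (snd (center (P w)) - snd (center (P v)))²
  = (radius (P v) + radius (P w))²).
{ intros v' w E; specialize (Htan w v' (hex_edge_sym _ _ E)); red in Htan.
  rewrite (Rplus_comm (radius (P v'))), <- Htan, Cmod_sqr; reflexivity. }
apply (flower_of_centres _ _
         (fun k => fst (center (P (add v (dir k)))) - fst (center (P v)))
         (fun k => snd (center (P (add v (dir k)))) - snd (center (P v)))); auto.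
- intros k; apply T, hex_edge_dir.
- intros k; rewrite <- (T _ _ (hex_edge_dir_succ v k)); unfold Rsqr; ring.
- intros k; assert (O := Hor _ _ _ (hex_positive_face_dir v k)).
  unfold ccw, Im, Cmult, Cconj, Cminus, Cplus, Copp in O; cbn [fst snd] in O; lra.
- intros k n Hn.
  assert (D : disjoint_interiors (P (add v (dir k))) (P (add v (dir (n + k))))).
  { apply (Huni v); try (right; apply hex_edge_dir).
    intros E; apply (dir_neq k n Hn); unfold add in E.
    injection E; intros E2 E1.
    destruct (dir (n + k)), (dir k); simpl in *; f_equal; lia. }
  apply disjoint_interiors_dist in D; auto.
  set (p := center (P (add v (dir k)))) in *.
  set (q := center (P (add v (dir (n + k))))) in *.
  apply Rsqr_incr_1 in D; [| |apply Cmod_ge_0].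
  + rewrite Cmod_sqr in D; simpl in D; unfold Rsqr, Rminus in *; lra.
  + assert (H1 := Hpos (add v (dir k))); assert (H2 := Hpos (add v (dir (n + k)))); lra.
Qed.

(** * Functions with constant increments *)

Lemma constant_Z (f : Z -> R) c :
  (forall m, f (m + 1)%Z - f m = c) -> forall m, f m = f 0%Z + IZR m * c.
Proof.
intros H.
assert (N : forall n : nat, f (Z.of_nat n) = f 0%Z + IZR (Z.of_nat n) * c /\
                            f (- Z.of_nat n)%Z = f 0%Z + IZR (- Z.of_nat n) * c).
{ induction n as [|n [IH1 IH2]]; [simpl; split; ring|].
  assert (E1 := H (Z.of_nat n)); assert (E2 := H (- Z.of_nat (S n))%Z).
  replace (- Z.of_nat (S n) + 1)%Z with (- Z.of_nat n)%Z in E2 by lia.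
  rewrite Nat2Z.inj_succ in *; unfold Z.succ in *.
  rewrite !opp_IZR, plus_IZR in *; lra. }
intros m; destruct (Z_le_gt_dec 0 m).
- rewrite <- (Z2Nat.id m) by easy; apply N.
- rewrite <- (Z.opp_involutive m), <- (Z2Nat.id (- m)) by lia; apply N.
Qed.

Lemma constant_Z2 (f : Z -> Z -> R) :
  (forall m n, f (m + 1)%Z n = f m n /\ f m (n + 1)%Z = f m n) ->
  forall m n, f m n = f 0%Z 0%Z.
Proof.
intros H m n.
rewrite (constant_Z (fun m => f m n) 0) by (intros i; destruct (H i n); lra).
rewrite (constant_Z (f 0%Z) 0) by (intros j; destruct (H 0%Z j); lra); ring.
Qed.

Lemma powerRZ_exp x m : powerRZ (exp x) m = exp (IZR m * x).
Proof.
rewrite powerRZ_Rpower by apply exp_pos; unfold Rpower; now rewrite ln_exp.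
Qed.

(** * The network of logarithmic radii *)

Definition angle_sum (u : vertex -> R) (v : vertex) : R :=
  turning (exp (u v)) (fun k => exp (u (add v (dir k)))) 0 6.

(** Mean over the segment from [u] to [u + w] of the derivative of the angle sum
    at [v] with respect to the value of [u] at [add v (dir (S k))]. *)
Definition conductance (u w : vertex -> R) (k : nat) (v : vertex) : R :=
  mean_weight u w v (add v (dir (S k))) (add v (dir k))
  + mean_weight u w v (add v (dir (S k))) (add v (dir (S (S k)))).

(** Each neighbour lies in two corners, whose coefficients add up. Index [k] of [conductance]
    concerns direction [S k], hence 5 for direction 0. *)
Lemma angle_sum_diff u w v :
  angle_sum (fun v => u v + w v) v - angle_sum u v
  = conductance u w 5 v * (w (add v (dir 0)) - w v)
    + conductance u w 0 v * (w (add v (dir 1)) - w v)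
    + conductance u w 1 v * (w (add v (dir 2)) - w v)
    + conductance u w 2 v * (w (add v (dir 3)) - w v)
    + conductance u w 3 v * (w (add v (dir 4)) - w v)
    + conductance u w 4 v * (w (add v (dir 5)) - w v).
Proof.
unfold angle_sum, conductance; cbn [turning Nat.add].
assert (D := fun k => corner_angle_diff u w v (add v (dir k)) (add v (dir (S k)))).
assert (D0 := D 0%nat); assert (D1 := D 1%nat); assert (D2 := D 2%nat).
assert (D3 := D 3%nat); assert (D4 := D 4%nat); assert (D5 := D 5%nat).
change (dir 6) with (dir 0) in *; change (dir 7) with (dir 1); lra.
Qed.

(** Seen from its other end, an edge has the opposite direction and its two triangles are exchanged;
    the network is thus undirected. *)
Lemma conductance_opp u w k v :
  conductance u w (3 + k) (add v (dir (S k))) = conductance u w k v.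
Proof.
assert (E : add (add v (dir (S k))) (dir (S (3 + k))) = v
  /\ add (add v (dir (S k))) (dir (3 + k)) = add v (dir (S (S k)))
  /\ add (add v (dir (S k))) (dir (S (S (3 + k)))) = add v (dir k)).
{ destruct v as [m n]; induction k using dir_ind; [..|exact IHk];
    unfold add; simpl; (split; [|split]); f_equal; ring. }
destruct E as [E1 [E2 E3]]; unfold conductance; rewrite E1, E2, E3.
rewrite !(mean_weight_sym u w (add v (dir (S k)))); ring.
Qed.

Lemma conductance_bounds u w k v : 0 < conductance u w k v <= 2.
Proof.
unfold conductance.
assert (H1 := mean_weight_bounds u w v (add v (dir (S k))) (add v (dir k))).
assert (H2 := mean_weight_bounds u w v (add v (dir (S k))) (add v (dir (S (S k))))).
lra.
Qed.

Lemma bounded_difference_constant u w B :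
  (forall v, Rabs (w v) <= B) ->
  (forall v, angle_sum (fun v => u v + w v) v = angle_sum u v) ->
  forall m n, w ((m + 1)%Z, n) = w (m, n) /\ w (m, (n + 1)%Z) = w (m, n).
Proof.
intros HB H m n.
set (at_ := fun (f : vertex -> R) i j => f ((m + i)%Z, (n + j)%Z)).
assert (L := bounded_harmonic_constant (at_ (conductance u w 5))
  (at_ (conductance u w 0)) (at_ (conductance u w 4)) (at_ w) B 2).
unfold at_ in L; rewrite !Z.add_0_r in L; apply L; clear L;
  try (intros; apply conductance_bounds); [intros; apply HB|].
intros i j; set (v := ((m + i)%Z, (n + j)%Z)).
assert (D := angle_sum_diff u w v); rewrite H, Rminus_diag in D.
(* Edges in directions 2, 3, 4 are reattached to their other ends, where they point in directions 5,
   0, 1. *)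
assert (C2 := conductance_opp u w 2 v); assert (C3 := conductance_opp u w 3 v).
assert (C1 := conductance_opp u w 1 v).
change (conductance u w (3 + 3)) with (conductance u w 0) in C3.
rewrite <- C1, <- C2, <- C3 in D; cbn [Nat.add] in D.
assert (E : forall p q, at_ w (i + p)%Z (j + q)%Z = w (add v (p, q))).
{ intros p q; unfold at_, add; simpl; do 2 f_equal; lia. }
assert (E' : forall c p q, at_ c (i - p)%Z (j - q)%Z = c (add v (- p, - q)%Z)).
{ intros c p q; unfold at_, add; simpl; do 2 f_equal; lia. }
assert (E0 : forall p q, w ((m + (i - p + p))%Z, (n + (j - q + q))%Z) = w v).
{ intros p q; unfold v; do 2 f_equal; lia. }
fold (at_ (conductance u w 5)) (at_ (conductance u w 0)) (at_ (conductance u w 4)) (at_ w).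
unfold div, flux; rewrite !E, !E'; unfold at_; rewrite !E0.
fold v; cbn [dir] in D; simpl Z.opp; lra.
Qed.

Theorem corollary1p7 (P : vertex -> circle) :
  circle_packing P -> univalent_flowers P ->
  regular_hexagonal_packing P \/ doyle_spiral P.
Proof.
intros HP HU; right; split; [easy|].
assert (Hpos : forall v, 0 < radius (P v)) by apply HP.
set (u := fun v => ln (radius (P v))).
assert (Eu : forall v, exp (u v) = radius (P v)) by (intros v; apply exp_ln, Hpos).
assert (flat : forall v, angle_sum u v = 2 * PI).
{ intros v; unfold angle_sum; rewrite Eu, <- (flower_turning _ _ 0 (packing_flower P v HP HU)).
  apply turning_ext; intros i; apply Eu. }
destruct ring_lemma as [M [HM HR]].
assert (lip : forall v w, hex_edge v w -> u v - u w <= ln M).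
{ intros v w E.
  assert (exists k, w = add v (dir k)) as [k ->].
  { destruct v as [m n], w as [m' n']; apply hex_edgeE in E; simpl in E.
    destruct E as [E|[E|[E|[E|[E|[E|E]]]]]]; [..|easy]; rewrite <- E;
      [exists 0%nat|exists 3%nat|exists 1%nat|exists 4%nat|exists 5%nat|exists 2%nat];
      unfold add; simpl; f_equal; ring. }
  assert (L := HR _ _ k (packing_flower P v HP HU)); simpl in L.
  assert (Q := Hpos (add v (dir k))).
  apply ln_le in L; [|apply Hpos]; rewrite ln_mult in L by easy; unfold u; lra. }
(* Here [u + w] is [u] translated by [d], with the same angle sums; the Ring Lemma at both ends of
   an edge bounds [w] by [ln M]. *)
assert (affine : forall d : vertex, (forall v, hex_edge v (add v d)) ->
  forall m n, let w v := u (add v d) - u v in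
  w ((m + 1)%Z, n) = w (m, n) /\ w (m, (n + 1)%Z) = w (m, n)).
{ intros d Hd m n w; apply (bounded_difference_constant u w (ln M)).
  - intros v; apply Rabs_le; unfold w.
    assert (L1 := lip _ _ (Hd v)); assert (L2 := lip _ _ (hex_edge_sym _ _ (Hd v))); lra.
  - intros v; rewrite flat, <- (flat (add v d)); unfold angle_sum, w.
    replace (u v + (u (add v d) - u v)) with (u (add v d)) by ring.
    apply turning_ext; intros i.
    replace (add (add v (dir i)) d) with (add (add v d) (dir i))
      by (unfold add; simpl; f_equal; ring).
    f_equal; ring. }
assert (A1 := affine (1, 0)%Z (fun v => hex_edge_dir v 0)).
assert (A2 := affine (0, 1)%Z (fun v => hex_edge_dir v 1)).
assert (D1 := constant_Z2 (fun m n => u (add (m, n) (1, 0)%Z) - u (m, n)) A1).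
assert (D2 := constant_Z2 (fun m n => u (add (m, n) (0, 1)%Z) - u (m, n)) A2).
unfold add in D1, D2; simpl in D1, D2.
(* The slopes of the affine function [u]; their exponentials are the ratios of the spiral. *)
set (alpha := u (1, 0)%Z - u (0, 0)%Z) in D1.
set (beta := u (0, 1)%Z - u (0, 0)%Z) in D2.
exists (exp (u (0, 0)%Z)), (exp alpha), (exp beta).
repeat split; try apply exp_pos.
intros m n; rewrite !powerRZ_exp, <- !exp_plus, <- Eu; f_equal.
rewrite (constant_Z (fun n => u (m, n)) beta)
  by (intros j; rewrite <- (D2 m j), Z.add_0_r; reflexivity).
rewrite (constant_Z (fun m => u (m, 0%Z)) alpha)
  by (intros i; rewrite <- (D1 i 0%Z); reflexivity).
reflexivity.
Qed.
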